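(* Let $j\ge 3$. For $c\in(0,1)$ and $d>0$ let $$v(c,d)=\frac d2\Bigl((c-1)j\ln(1-c)-2c\ln c+(1+c)(2-j)(1-\ln d)\Bigr),$$ and let $\bar\beta_j$ be the unique $d>0$ such that $\sup_{c\in(0,1)}v(c,d)=0$ (equivalently, the positive root of $v(d)$, where $v(d)=\max_{c}v(c,d)$ is attained at $d=(1-c)^{-j/(j-2)}c^{2/(j-2)}$). With $E_{n,j,k}$ as defined in the context, for every $\theta\in(0,1)$ there exists $K<\infty$ such that for all integers $k\ge K$, $$\lim_{n\to\infty,\ k\mid n}\ \sum_{b=1}^{\lfloor \theta\bar\beta_j (k-1)^{-j/(j-2)}n\rfloor}\ \sum_{a=0}^{n-b}E_{n,j,k}\!\left(\tfrac an,\tfrac bn\right)=0.$$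
   Context: Let $g_k(x,y)=(1+x+y)^k-ky-\bigl((1+x)^k-1\bigr)$. For $n$ a multiple of $k$ and integers $a,b\ge0$ with $a+b\le n$, $E_{n,j,k}(a/n,b/n)=\binom{n}{a,\,b,\,n-a-b}S_{n,j,k}(a,b)\big/\binom{nj}{ja,\,jb,\,j(n-a-b)}$ with $S_{n,j,k}(a,b)$ the coefficient of $x^{ja}y^{jb}$ in $g_k(x,y)^{nj/k}$. This is the average number of LM1 stopping sets (for verification decoding on the $q$-ary symmetric channel) with $a$ correct and $b$ incorrect unverified variable nodes in a random $(j,k)$-regular LDPC code of length $n$; the vanishing of the sum means that, with high probability, LM1 corrects all error patterns of size below $\theta\bar\beta_j(k-1)^{-j/(j-2)}n$ when no false verification occurs. *)

(* Defs.v *)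
From Stdlib Require Import Reals Lra Lia Arith.
Open Scope R_scope.

Fixpoint rsum (m : nat) (f : nat -> R) : R :=
  match m with
  | O => 0
  | S m' => rsum m' f + f m'
  end.

Definition trinom (n a b : nat) : R :=
  if Nat.leb (a + b) n then
    INR (fact n) / (INR (fact a) * INR (fact b) * INR (fact (n - a - b)))
  else 0.

(* Bivariate polynomials represented by their coefficient functions:
   P p q = coefficient of x^p y^q. *)
Definition bipoly := nat -> nat -> R.

Definition bimul (P Q : bipoly) : bipoly :=
  fun p q => rsum (S p) (fun i => rsum (S q) (fun l => P i l * Q (p - i)%nat (q - l)%nat)).

Definition bione : bipoly :=
  fun p q => if (Nat.eqb p 0 && Nat.eqb q 0)%bool then 1 else 0.

Fixpoint bipow (P : bipoly) (m : nat) : bipoly :=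
  match m with
  | O => bione
  | S m' => bimul P (bipow P m')
  end.

Definition ind (b : bool) : R := if b then 1 else 0.

(* g_k(x,y) = (1+x+y)^k - k y - ((1+x)^k - 1), coefficientwise;
   note trinom k p 0 = binom(k,p) is the coefficient of x^p in (1+x)^k *)
Definition g_coef (k : nat) : bipoly :=
  fun p q =>
    trinom k p q
    - INR k * ind (Nat.eqb p 0 && Nat.eqb q 1)
    - (trinom k p 0 * ind (Nat.eqb q 0) - ind (Nat.eqb p 0 && Nat.eqb q 0)).

Definition S_njk (n j k a b : nat) : R :=
  bipow (g_coef k) ((n * j) / k) (j * a)%nat (j * b)%nat.

(* E_{n,j,k}(a/n, b/n), indexed by the integers a, b *)
Definition E_njk (n j k a b : nat) : R :=
  trinom n a b * S_njk n j k a b / trinom (n * j) (j * a) (j * b).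

Definition vfun (j : nat) (c d : R) : R :=
  d / 2 * ((c - 1) * INR j * ln (1 - c) - 2 * c * ln c
           + (1 + c) * (2 - INR j) * (1 - ln d)).

Definition bmax (j k : nat) (theta beta : R) (n : nat) : nat :=
  Z.to_nat (Int_part (theta * beta * Rpower (INR k - 1) (- INR j / (INR j - 2)) * INR n)).

Definition LM1sum (j k : nat) (theta beta : R) (n : nat) : R :=
  rsum (bmax j k theta beta n)
    (fun i => let b := S i in rsum (S n - b) (fun a => E_njk n j k a b)).

(* Main.v *)
Require Import Defs.
From Stdlib Require Import Reals Lra Lia Arith.
Open Scope R_scope.

(** Since [g_k] has nonnegative coefficients, the coefficient of [x^(ja) y^(jb)]
    in [g_k^m] is at most [g_k(x,y)^m / (x^(ja) y^(jb))] for all [x, y >= 0], and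
    [g_k(x,y) <= 1 + k(k-1)(xy + y^2/2) exp((k-1)(x+y))]: every check node that is
    touched costs at least [xy] or [y^2].  With [c = a/b], [eps^2 = (k-1)b/n],
    [x = w eps/(k-1)], [y = u eps/(k-1)] and Stirling's bounds, [E(a,b)] is at most
    a polynomial in [a, b] times [exp(b rate)]; as [eps -> 0] the minimum of the rate
    over [u, w] is [v(c,d)/d] for [c < 1], where [d = (b/n)(k-1)^(j/(j-2))].
    Moving [d] from [bar beta] down to [theta bar beta] lowers the rate by
    [(1+c)(j-2)/2 ln(1/theta)], which absorbs all the errors once [k], hence
    [1/eps], is large.  The case [a > (k-1)b] is void because each touched check
    node carries a [y].  What remains is at most [C n^(-1/2) q^(a+b)] with [q < 1],
    which sums to [O(n^(-1/2))]. *)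

(** * Finite sums, with the geometric and exponential series *)

Lemma rsum_le m f g : (forall i, (i < m)%nat -> f i <= g i) -> rsum m f <= rsum m g.
Proof.
induction m as [|m IH]; simpl; intros h; [lra|].
apply Rplus_le_compat; [apply IH; intros; apply h; lia | apply h; lia].
Qed.

Lemma rsum_ge0 m f : (forall i, (i < m)%nat -> 0 <= f i) -> 0 <= rsum m f.
Proof.
induction m as [|m IH]; simpl; intros h; [lra|].
apply Rplus_le_le_0_compat; [apply IH; intros; apply h; lia | apply h; lia].
Qed.

Lemma rsum_ext m f g : (forall i, (i < m)%nat -> f i = g i) -> rsum m f = rsum m g.
Proof.
induction m as [|m IH]; simpl; intros h; [reflexivity|].
rewrite IH, h by (intros; try apply h; lia). reflexivity.
Qed.

Lemma rsum_mulr m f c : rsum m (fun i => f i * c) = rsum m f * c.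
Proof. induction m as [|m IH]; simpl; [lra | rewrite IH; lra]. Qed.

Lemma rsum_mull m f c : rsum m (fun i => c * f i) = c * rsum m f.
Proof. induction m as [|m IH]; simpl; [lra | rewrite IH; lra]. Qed.

Lemma rsum_add m f g : rsum m (fun i => f i + g i) = rsum m f + rsum m g.
Proof. induction m as [|m IH]; simpl; [lra | rewrite IH; lra]. Qed.

Lemma rsum_prod m n f g :
  rsum m (fun i => rsum n (fun l => f i * g l)) = rsum m f * rsum n g.
Proof. rewrite <- rsum_mulr. apply rsum_ext; intros; apply rsum_mull. Qed.

Lemma rsum_recl m f : rsum (S m) f = f O + rsum m (fun i => f (S i)).
Proof.
induction m as [|m IH]; [simpl; lra|].
change (rsum (S (S m)) f) with (rsum (S m) f + f (S m)). rewrite IH. simpl. lra.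
Qed.

Lemma rsum_eq0 m f : (forall i, (i < m)%nat -> f i = 0) -> rsum m f = 0.
Proof.
induction m as [|m IH]; simpl; intros h; [reflexivity|].
rewrite IH, h by (intros; try apply h; lia). lra.
Qed.

Lemma rsum_geom_le m q : 0 < q < 1 -> rsum m (fun i => q ^ i) <= / (1 - q).
Proof.
intros hq.
assert (h : rsum m (fun i => q ^ i) * (1 - q) = 1 - q ^ m).
{ induction m as [|m IH]; simpl; [lra|]. rewrite Rmult_plus_distr_r, IH. ring. }
apply Rmult_le_reg_r with (1 - q); [lra|].
rewrite h, Rinv_l by lra. assert (0 < q ^ m) by (apply pow_lt; lra). lra.
Qed.

Lemma rsum_sum_f_R0 m f : rsum (S m) f = sum_f_R0 f m.
Proof.
induction m as [|m IH]; [simpl; lra|].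
change (rsum (S (S m)) f) with (rsum (S m) f + f (S m)). rewrite IH. reflexivity.
Qed.

Lemma rsum_exp_le m x : 0 <= x -> rsum m (fun i => x ^ i / INR (fact i)) <= exp x.
Proof.
intros hx.
destruct m as [|m]; [left; apply exp_pos|].
rewrite rsum_sum_f_R0.
apply sum_incr.
- unfold exp. destruct (exist_exp x) as [l hl]; simpl.
  intros e he. destruct (hl e he) as [N hN]. exists N. intros n hn.
  specialize (hN n hn).
  replace (sum_f_R0 (fun i => x ^ i / INR (fact i)) n)
    with (sum_f_R0 (fun i => / INR (fact i) * x ^ i) n); [exact hN|].
  apply sum_eq. intros; unfold Rdiv; ring.
- intros n. apply Rmult_le_pos; [apply pow_le; lra|].
  left; apply Rinv_0_lt_compat, INR_fact_lt_0.
Qed.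

(** * Falling factorials, logarithms and Stirling's bounds *)

Lemma fact_falling_le n t : (t <= n)%nat ->
  INR (fact n) <= INR n ^ t * INR (fact (n - t)).
Proof.
induction t as [|t IH]; intros h.
- rewrite Nat.sub_0_r. simpl. lra.
- apply Rle_trans with (1 := IH ltac:(lia)).
  replace (n - t)%nat with (S (n - S t)) by lia.
  rewrite fact_simpl, mult_INR. simpl (INR n ^ S t).
  assert (INR (S (n - S t)) <= INR n) by (apply le_INR; lia).
  assert (0 <= INR n ^ t) by (apply pow_le, pos_INR).
  assert (0 <= INR (fact (n - S t))) by apply pos_INR.
  assert (0 <= INR n ^ t * INR (fact (n - S t))) by nra.
  nra.
Qed.

Lemma fact_falling_ge n t : (t <= n)%nat ->
  INR (n - t) ^ t * INR (fact (n - t)) <= INR (fact n).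
Proof.
intros h0.
(* The base [n - t] stays fixed while the number [r] of factors grows. *)
assert (H : forall r, (r <= t)%nat ->
  INR (n - t) ^ r * INR (fact (n - r)) <= INR (fact n)).
{ induction r as [|r IH]; intros h.
  - rewrite Nat.sub_0_r. simpl. lra.
  - apply Rle_trans with (2 := IH ltac:(lia)).
    replace (n - r)%nat with (S (n - S r)) by lia.
    rewrite fact_simpl, mult_INR. simpl (INR (n - t) ^ S r).
    assert (INR (n - t) <= INR (S (n - S r))) by (apply le_INR; lia).
    assert (0 <= INR (n - t) ^ r) by (apply pow_le, pos_INR).
    assert (0 <= INR (fact (n - S r))) by apply pos_INR.
    assert (0 <= INR (n - t) ^ r * INR (fact (n - S r))) by nra.
    nra. }
apply H; lia.
Qed.

Lemma ln_le x y : 0 < x -> x <= y -> ln x <= ln y.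
Proof. intros hx [h| ->]; [left; apply ln_increasing; lra | lra]. Qed.

Lemma exp_le x y : x <= y -> exp x <= exp y.
Proof. intros [h| ->]; [left; apply exp_increasing; lra | lra]. Qed.

Lemma ln_le_sub1 x : 0 < x -> ln x <= x - 1.
Proof.
intros h. assert (h1 := exp_ineq1_le (ln x)). rewrite exp_ln in h1; lra.
Qed.

(** Induction: from [M] to [M+1] the left side grows by at most [ln (M+1)], because
    [M ln ((M+1)/M) <= 1]. *)
Lemma ln_fact_ge m : INR m * ln (INR m) - INR m <= ln (INR (fact m)).
Proof.
induction m as [|m IH]; [simpl; rewrite ln_1; lra|].
rewrite fact_simpl, mult_INR, ln_mult;
  [|apply lt_0_INR; lia | apply INR_fact_lt_0].
destruct m as [|m]; [simpl; rewrite ln_1; lra|].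
set (M := S m) in *.
assert (hM : 0 < INR M) by (apply lt_0_INR; lia).
rewrite S_INR in *.
assert (h : ln ((INR M + 1) / INR M) <= 1 / INR M).
{ apply Rle_trans with ((INR M + 1) / INR M - 1).
  - apply ln_le_sub1, Rdiv_lt_0_compat; lra.
  - right; field; lra. }
unfold Rdiv in h. rewrite ln_mult, ln_Rinv in h; try lra; [|apply Rinv_0_lt_compat; lra].
apply (Rmult_le_compat_l (INR M)) in h; [|lra].
replace (INR M * (1 * / INR M)) with 1 in h by (field; lra). nra.
Qed.

(** The last logarithm is taken at [m + 1] so that [m = 0] is covered, which arises as [ja] with
    [a = 0]. *)
Lemma ln_fact_le m :
  ln (INR (fact m)) <= INR m * ln (INR m) - INR m + 1 + ln (INR m + 1).
Proof.
(* For positive arguments the sharper error [1 + ln m] passes through the induction, by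
   [(M+1) ln (M/(M+1)) <= -1]. *)
assert (H : forall m, ln (INR (fact (S m))) <=
  INR (S m) * ln (INR (S m)) - INR (S m) + 1 + ln (INR (S m))).
{ clear m; induction m as [|m IH]; [simpl; rewrite ln_1; lra|].
  rewrite fact_simpl, mult_INR, ln_mult;
    [|apply lt_0_INR; lia | apply INR_fact_lt_0].
  set (M := S m) in *.
  assert (hM : 0 < INR M) by (apply lt_0_INR; lia).
  rewrite S_INR in *.
  assert (h : ln (INR M / (INR M + 1)) <= - (1 / (INR M + 1))).
  { apply Rle_trans with (INR M / (INR M + 1) - 1).
    - apply ln_le_sub1, Rdiv_lt_0_compat; lra.
    - right; field; lra. }
  unfold Rdiv in h. rewrite ln_mult, ln_Rinv in h; try lra; [|apply Rinv_0_lt_compat; lra].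
  apply (Rmult_le_compat_l (INR M + 1)) in h; [|lra].
  replace ((INR M + 1) * - (1 * / (INR M + 1))) with (-1) in h by (field; lra). nra. }
destruct m as [|m].
- simpl. rewrite Rplus_0_l, ln_1. lra.
- apply Rle_trans with (1 := H m).
  assert (0 < INR (S m)) by (apply lt_0_INR; lia).
  assert (ln (INR (S m)) <= ln (INR (S m) + 1)) by (apply ln_le; lra). lra.
Qed.

(** * Coefficients of powers of a bivariate polynomial *)

Section Coefficients.

Variable P : bipoly.
Hypothesis P_ge0 : forall p q, 0 <= P p q.

Lemma bipow_ge0 m p q : 0 <= bipow P m p q.
Proof.
revert p q; induction m as [|m IH]; intros p q; simpl.
- unfold bione. destruct (_ && _)%bool; lra.
- unfold bimul. apply rsum_ge0; intros; apply rsum_ge0; intros.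
  apply Rmult_le_pos; auto.
Qed.

(** A [bipoly] carries no degree bound, so instead of a value at [(x, y)] a bound [G] on the sums
    over all finite rectangles is used. Each term of the convolution splits [x^p y^q] between its
    two factors, and nonnegativity allows them to be bounded separately. *)
Lemma bipow_coef_le x y G m p q : 0 <= x -> 0 <= y -> 0 <= G ->
  (forall p q, rsum (S p) (fun i => rsum (S q) (fun l => P i l * (x ^ i * y ^ l))) <= G) ->
  bipow P m p q * (x ^ p * y ^ q) <= G ^ m.
Proof.
intros hx hy hG hP; revert p q; induction m as [|m IH]; intros p q; simpl bipow.
- unfold bione. destruct (Nat.eqb_spec p O) as [->|], (Nat.eqb_spec q 0) as [->|]; simpl; lra.
- unfold bimul. rewrite <- rsum_mulr.
  apply Rle_trans with
    (rsum (S p) (fun i => rsum (S q) (fun l => P i l * (x ^ i * y ^ l))) * G ^ m).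
  + rewrite <- rsum_mulr. apply rsum_le; intros i hi.
    rewrite <- !rsum_mulr. apply rsum_le; intros l hl.
    replace (x ^ p) with (x ^ i * x ^ (p - i))
      by (rewrite <- pow_add; f_equal; lia).
    replace (y ^ q) with (y ^ l * y ^ (q - l))
      by (rewrite <- pow_add; f_equal; lia).
    replace (P i l * bipow P m (p - i)%nat (q - l)%nat *
        (x ^ i * x ^ (p - i) * (y ^ l * y ^ (q - l))))
      with (P i l * (x ^ i * y ^ l) *
        (bipow P m (p - i)%nat (q - l)%nat * (x ^ (p - i) * y ^ (q - l)))) by ring.
    apply Rmult_le_compat_l; [|apply IH].
    apply Rmult_le_pos; [apply P_ge0 | apply Rmult_le_pos; apply pow_le; lra].
  + simpl. apply Rmult_le_compat_r; [apply pow_le; lra | apply hP].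
Qed.

(** If [p > r q], every splitting of [(p, q)] leaves a factor whose [x]-exponent exceeds [r] times
    its [y]-exponent. *)
Lemma bipow_support r m p q :
  (forall p q, (r * q < p)%nat -> P p q = 0) -> (r * q < p)%nat -> bipow P m p q = 0.
Proof.
intros hP; revert p q; induction m as [|m IH]; intros p q h; simpl.
- unfold bione. destruct (Nat.eqb_spec p O) as [->|]; [lia | reflexivity].
- unfold bimul. apply rsum_eq0; intros i hi; apply rsum_eq0; intros l hl.
  destruct (Nat.lt_ge_cases (r * l) i) as [h1|h1].
  + rewrite hP by assumption. ring.
  + rewrite IH; [ring|]. rewrite Nat.mul_sub_distr_l. nia.
Qed.

End Coefficients.

(** * The check polynomial and the coefficients of its powers *)

Lemma trinom_ge0 n a b : 0 <= trinom n a b.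
Proof.
unfold trinom. destruct (Nat.leb _ _); [|lra].
apply Rmult_le_pos; [apply pos_INR|].
left; apply Rinv_0_lt_compat.
repeat apply Rmult_lt_0_compat; apply INR_fact_lt_0.
Qed.

(* Factoring out the two forced edges: k!/(k-p-q)! = k(k-1) (k-2)!/(k-p-q)!. *)
Lemma trinom_le k p q : (2 <= p + q)%nat -> (1 <= k)%nat ->
  trinom k p q <=
  INR k * (INR k - 1) * (INR k - 1) ^ (p + q - 2) / (INR (fact p) * INR (fact q)).
Proof.
intros h2 hk.
assert (hp := INR_fact_lt_0 p). assert (hq := INR_fact_lt_0 q).
assert (hk1 : 0 <= INR k - 1) by (apply le_INR in hk; simpl in hk; lra).
unfold trinom. destruct (Nat.leb_spec (p + q) k) as [h|h].
- assert (hr := INR_fact_lt_0 (k - p - q)).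
  assert (h1 := fact_falling_le (k - 2) (p + q - 2) ltac:(lia)).
  replace (k - 2 - (p + q - 2))%nat with (k - p - q)%nat in h1 by lia.
  assert (h3 : INR (fact k) = INR k * (INR k - 1) * INR (fact (k - 2))).
  { replace k with (S (S (k - 2))) at 1 by lia. rewrite !fact_simpl, !mult_INR, !S_INR.
    rewrite minus_INR by lia. simpl. ring. }
  assert (h4 : INR (k - 2) ^ (p + q - 2) <= (INR k - 1) ^ (p + q - 2)).
  { apply pow_incr. split; [apply pos_INR|]. rewrite minus_INR by lia. simpl. lra. }
  apply Rmult_le_reg_r with (INR (fact p) * INR (fact q) * INR (fact (k - p - q)));
    [repeat apply Rmult_lt_0_compat; lra|].
  unfold Rdiv. rewrite Rmult_assoc, Rinv_l
    by (repeat apply Rmult_integral_contrapositive_currified; lra).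
  replace (INR k * (INR k - 1) * (INR k - 1) ^ (p + q - 2) * / (INR (fact p) * INR (fact q)) *
    (INR (fact p) * INR (fact q) * INR (fact (k - p - q))))
    with (INR k * (INR k - 1) * ((INR k - 1) ^ (p + q - 2) * INR (fact (k - p - q))))
    by (field; lra).
  rewrite h3, Rmult_1_r. apply Rmult_le_compat_l; [apply Rmult_le_pos; [apply pos_INR | lra]|].
  apply Rle_trans with (1 := h1). apply Rmult_le_compat_r; lra.
- apply Rmult_le_pos.
  + repeat apply Rmult_le_pos; try apply pow_le; try apply pos_INR; lra.
  + left; apply Rinv_0_lt_compat; nra.
Qed.

Definition exp_term (z : R) (i : nat) : R := z ^ i / INR (fact i).

Lemma exp_term_ge0 z i : 0 <= z -> 0 <= exp_term z i.
Proof.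
intros; apply Rmult_le_pos; [apply pow_le; lra|].
left; apply Rinv_0_lt_compat, INR_fact_lt_0.
Qed.

(** Moves a coefficient sequence up one degree: the factors [xy] and [y^2] taken out of the check
    polynomial reappear as shifts of the index. *)
Definition shift1 (f : nat -> R) (i : nat) : R := match i with O => 0 | S i => f i end.

Lemma rsum_shift1_le f m c : 0 <= c -> (forall m, rsum m f <= c) -> rsum m (shift1 f) <= c.
Proof.
intros hc h; destruct m as [|m]; [simpl; lra|].
rewrite rsum_recl. cbn [shift1]. specialize (h m).
change (rsum m (fun i => f i)) with (rsum m f). lra.
Qed.

Lemma rsum_ind0_le m : rsum m (fun i => Defs.ind (Nat.eqb i O)) <= 1.
Proof.
destruct m as [|m]; [simpl; lra|].
rewrite rsum_recl. rewrite rsum_eq0; [unfold Defs.ind; simpl; lra | reflexivity].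
Qed.

Section CheckPolynomial.

Variable k : nat.
Hypothesis k_ge1 : (1 <= k)%nat.

Lemma trinom01 : trinom k 0 1 = INR k.
Proof.
unfold trinom. destruct (Nat.leb_spec (0 + 1) k) as [h|h]; [|lia].
replace (k - 0 - 1)%nat with (k - 1)%nat by lia.
replace (fact k) with (k * fact (k - 1))%nat.
- rewrite mult_INR. simpl (fact 0). simpl (fact 1). simpl (INR 1). field. apply INR_fact_neq_0.
- destruct k as [|m]; [lia|]. simpl (S m - 1)%nat. rewrite Nat.sub_0_r, fact_simpl. reflexivity.
Qed.

Lemma g_coef_y0 p : g_coef k p O = Defs.ind (Nat.eqb p O).
Proof.
unfold g_coef. rewrite Bool.andb_false_r, Bool.andb_true_r. simpl. lra.
Qed.

Lemma g_coef01 : g_coef k 0%nat 1%nat = 0.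
Proof. unfold g_coef. rewrite trinom01. simpl. lra. Qed.

Lemma g_coef_trinom p q : (2 <= p + q)%nat -> (1 <= q)%nat -> g_coef k p q = trinom k p q.
Proof.
intros h2 h1. unfold g_coef.
replace (Nat.eqb q O) with false by (symmetry; apply Nat.eqb_neq; lia).
replace (Nat.eqb p O && Nat.eqb q 1%nat)%bool with false.
- rewrite Bool.andb_false_r. simpl. lra.
- destruct (Nat.eqb_spec p O), (Nat.eqb_spec q 1); simpl; try reflexivity; lia.
Qed.

Lemma g_coef_ge0 p q : 0 <= g_coef k p q.
Proof.
destruct q as [|q].
- rewrite g_coef_y0. unfold Defs.ind. destruct (Nat.eqb p O); lra.
- destruct (Nat.le_gt_cases 2 (p + S q)) as [h|h].
  + rewrite g_coef_trinom by lia. apply trinom_ge0.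
  + replace p with O by lia. replace q with O by lia. rewrite g_coef01. lra.
Qed.

(** A nonconstant monomial of [g_k] carries a [y] and has degree at most [k], so
    [p <= k - q <= (k-1) q]. *)
Lemma g_coef_support p q : ((k - 1) * q < p)%nat -> g_coef k p q = 0.
Proof.
intros h. destruct q as [|q].
- rewrite g_coef_y0. destruct p; [lia | reflexivity].
- destruct (Nat.le_gt_cases 2 (p + S q)) as [h1|h1].
  + rewrite g_coef_trinom by lia. unfold trinom.
    destruct (Nat.leb_spec (p + S q) k) as [h2|h2]; [nia | reflexivity].
  + replace p with O by lia. replace q with O by lia. apply g_coef01.
Qed.

(** Split by the power of [y]: [q = 0] leaves only the constant 1, [q = 1] forces a factor [xy]
    because [k y] was subtracted, and [q >= 2] gives [y^2]. Each part is a sequence in [p] times a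
    sequence in [q], so that its double sum factors. *)
Lemma g_coef_le x y p q : 0 <= x -> 0 <= y ->
  let X := (INR k - 1) * x in let Y := (INR k - 1) * y in
  g_coef k p q * (x ^ p * y ^ q) <=
    Defs.ind (Nat.eqb p O) * Defs.ind (Nat.eqb q O)
    + (INR k * (INR k - 1) * (x * y) * shift1 (exp_term X) p)
        * shift1 (fun l => Defs.ind (Nat.eqb l O)) q
    + (INR k * (INR k - 1) * (y * y / 2) * exp_term X p) * shift1 (shift1 (exp_term Y)) q.
Proof.
intros hx hy X Y.
assert (hk1 : 0 <= INR k - 1) by (apply le_INR in k_ge1; simpl in k_ge1; lra).
assert (hk0 : 0 <= INR k) by lra.
assert (hX : 0 <= X) by (apply Rmult_le_pos; lra).
assert (hY : 0 <= Y) by (apply Rmult_le_pos; lra).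
assert (hkk : 0 <= INR k * (INR k - 1)) by (apply Rmult_le_pos; lra).
destruct q as [|[|q]]; simpl shift1.
- rewrite g_coef_y0. destruct p as [|p]; unfold Defs.ind; simpl; lra.
- destruct p as [|p].
  + rewrite g_coef01. unfold Defs.ind; simpl. lra.
  + rewrite g_coef_trinom by lia.
    assert (ht := trinom_le k (S p) 1 ltac:(lia) k_ge1).
    replace (S p + 1 - 2)%nat with p in ht by lia.
    assert (hxy : 0 <= x ^ S p * y ^ 1) by (apply Rmult_le_pos; apply pow_le; lra).
    apply (Rmult_le_compat_r _ _ _ hxy) in ht. apply Rle_trans with (1 := ht).
    unfold Defs.ind, exp_term; simpl Nat.eqb; cbv iota. rewrite !Rmult_0_l, Rmult_0_r, Rplus_0_r, Rplus_0_l.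
    assert (hf := INR_fact_lt_0 p).
    assert (hf1 : / INR (fact (S p)) <= / INR (fact p)).
    { apply Rinv_le_contravar; [lra|]. apply le_INR, fact_le; lia. }
    assert (hA : 0 <= INR k * (INR k - 1) * (x * y) * X ^ p).
    { repeat apply Rmult_le_pos; try apply pow_le; lra. }
    apply (Rmult_le_compat_l _ _ _ hA) in hf1.
    unfold X in *. rewrite Rpow_mult_distr in *.
    assert (hf2 := INR_fact_lt_0 (S p)).
    match goal with |- ?L <= _ =>
      replace L with (INR k * (INR k - 1) * (x * y) * ((INR k - 1) ^ p * x ^ p) * / INR (fact (S p)))
    end.
    * apply Rle_trans with (1 := hf1). right. simpl shift1.
      rewrite Rpow_mult_distr. unfold Rdiv. ring.
    * simpl (x ^ S p). simpl (y ^ 1). simpl (fact 1). simpl (INR 1). field. lra.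
- rewrite g_coef_trinom by lia.
  assert (ht := trinom_le k p (S (S q)) ltac:(lia) k_ge1).
  replace (p + S (S q) - 2)%nat with (p + q)%nat in ht by lia.
  assert (hxy : 0 <= x ^ p * y ^ S (S q)) by (apply Rmult_le_pos; apply pow_le; lra).
  apply (Rmult_le_compat_r _ _ _ hxy) in ht. apply Rle_trans with (1 := ht).
  cbn [shift1 Nat.eqb]. change (Defs.ind false) with 0.
  rewrite !Rmult_0_r, !Rplus_0_l.
  unfold exp_term.
  assert (hf := INR_fact_lt_0 q). assert (hfp := INR_fact_lt_0 p).
  assert (hf2 := INR_fact_lt_0 (S (S q))).
  (* [(q+2)! >= 2 q!] produces the 1/2 in [y^2/2]. *)
  assert (hf1 : / INR (fact (S (S q))) <= / (2 * INR (fact q))).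
  { apply Rinv_le_contravar; [lra|].
    replace 2 with (INR 2) by reflexivity. rewrite <- mult_INR. apply le_INR.
    rewrite !fact_simpl. assert (0 < fact q)%nat by apply lt_O_fact. nia. }
  assert (hA : 0 <= INR k * (INR k - 1) * (y * y) * (X ^ p / INR (fact p)) * Y ^ q).
  { repeat apply Rmult_le_pos; try apply pow_le; try lra.
    left; apply Rinv_0_lt_compat; lra. }
  apply (Rmult_le_compat_l _ _ _ hA) in hf1.
  match goal with |- ?L <= ?M =>
    match type of hf1 with ?L1 <= ?M1 => replace L with L1; [replace M with M1; [exact hf1|]|] end
  end.
  + field. lra.
  + unfold X, Y. rewrite !Rpow_mult_distr, pow_add. simpl (y ^ S (S q)). field. lra.
Qed.

Lemma g_rect_le x y p q : 0 <= x -> 0 <= y ->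
  rsum (S p) (fun i => rsum (S q) (fun l => g_coef k i l * (x ^ i * y ^ l))) <=
  1 + INR k * (INR k - 1) * (x * y + y * y / 2) * exp ((INR k - 1) * (x + y)).
Proof.
intros hx hy.
assert (hk1 : 0 <= INR k - 1) by (apply le_INR in k_ge1; simpl in k_ge1; lra).
assert (hkk : 0 <= INR k * (INR k - 1)) by (apply Rmult_le_pos; lra).
set (X := (INR k - 1) * x). set (Y := (INR k - 1) * y).
assert (hX : 0 <= X) by (apply Rmult_le_pos; lra).
assert (hY : 0 <= Y) by (apply Rmult_le_pos; lra).
assert (hxy : 0 <= x * y) by (apply Rmult_le_pos; lra).
assert (hyy : 0 <= y * y / 2) by nra.
set (s1 := rsum (S p) (fun i => Defs.ind (Nat.eqb i O)) * rsum (S q) (fun i => Defs.ind (Nat.eqb i O))).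
set (s2 := INR k * (INR k - 1) * (x * y) * rsum (S p) (shift1 (exp_term X))
  * rsum (S q) (shift1 (fun l => Defs.ind (Nat.eqb l O)))).
set (s3 := INR k * (INR k - 1) * (y * y / 2) * rsum (S p) (exp_term X)
  * rsum (S q) (shift1 (shift1 (exp_term Y)))).
apply Rle_trans with (s1 + s2 + s3).
{ unfold s1, s2, s3.
  rewrite <- (rsum_mull (S p) (shift1 (exp_term X))), <- (rsum_mull (S p) (exp_term X)).
  rewrite <- !rsum_prod, <- !rsum_add.
  apply rsum_le; intros i _. rewrite <- !rsum_add.
  apply rsum_le; intros l _. apply g_coef_le; assumption. }
assert (hi0 : forall i, 0 <= Defs.ind (Nat.eqb i O)) by (intros i; unfold Defs.ind; destruct (Nat.eqb i O); lra).
assert (hs1 : s1 <= 1).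
{ apply Rle_trans with (1 * 1); [|lra].
  apply Rmult_le_compat; try apply rsum_ge0; auto using rsum_ind0_le. }
assert (heX := exp_pos X). assert (heY := exp_pos Y).
assert (heX1 : 1 <= exp X) by (assert (h := exp_ineq1_le X); lra).
assert (heY1 : 1 <= exp Y) by (assert (h := exp_ineq1_le Y); lra).
assert (hshift : forall f, (forall i, 0 <= f i) -> forall i, 0 <= shift1 f i).
{ intros f hf [|i]; simpl; auto; lra. }
assert (hE : forall z, 0 <= z -> forall i, 0 <= exp_term z i) by (intros; apply exp_term_ge0; assumption).
assert (hs2 : s2 <= INR k * (INR k - 1) * (x * y) * exp X * 1).
{ apply Rmult_le_compat.
  - apply Rmult_le_pos; [apply Rmult_le_pos; lra | apply rsum_ge0; intros; apply hshift; auto].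
  - apply rsum_ge0; intros; apply hshift; auto.
  - apply Rmult_le_compat_l; [apply Rmult_le_pos; lra|].
    apply rsum_shift1_le; [lra | intros; apply rsum_exp_le; lra].
  - apply rsum_shift1_le; [lra | apply rsum_ind0_le]. }
assert (hs3 : s3 <= INR k * (INR k - 1) * (y * y / 2) * exp X * exp Y).
{ apply Rmult_le_compat.
  - apply Rmult_le_pos; [apply Rmult_le_pos; lra | apply rsum_ge0; auto].
  - apply rsum_ge0; intros; apply hshift; auto.
  - apply Rmult_le_compat_l; [apply Rmult_le_pos; lra | apply rsum_exp_le; lra].
  - apply rsum_shift1_le; [lra | intros; apply rsum_shift1_le; [lra|]].
    intros; apply rsum_exp_le; lra. }
replace ((INR k - 1) * (x + y)) with (X + Y) by (unfold X, Y; ring). rewrite exp_plus.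
(* The part linear in [y] is enlarged by [exp Y], so that it shares the factor [exp (X + Y)] with
   the quadratic part. *)
assert (h4 : INR k * (INR k - 1) * (x * y) * exp X * 1 <=
  INR k * (INR k - 1) * (x * y) * exp X * exp Y).
{ apply Rmult_le_compat_l; [|lra]. repeat apply Rmult_le_pos; lra. }
nra.
Qed.

(** The rectangle bound [1 + h] is replaced by [exp h], which makes the power linear in the
    exponent. *)
Lemma g_pow_coef_le x y m p q : 0 <= x -> 0 <= y ->
  bipow (g_coef k) m p q * (x ^ p * y ^ q) <=
  exp (INR m * (INR k * (INR k - 1) * (x * y + y * y / 2) * exp ((INR k - 1) * (x + y)))).
Proof.
intros hx hy.
assert (hk1 : 0 <= INR k - 1) by (apply le_INR in k_ge1; simpl in k_ge1; lra).
set (h := INR k * (INR k - 1) * (x * y + y * y / 2) * exp ((INR k - 1) * (x + y))).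
assert (hh : 0 <= h).
{ apply Rmult_le_pos; [|left; apply exp_pos].
  apply Rmult_le_pos; [apply Rmult_le_pos; lra | nra]. }
apply Rle_trans with ((1 + h) ^ m).
- apply bipow_coef_le; try lra; [apply g_coef_ge0 | intros; apply g_rect_le; assumption].
- apply Rle_trans with (exp h ^ m).
  + apply pow_incr. split; [lra | apply exp_ineq1_le].
  + right. rewrite <- Rpower_pow by apply exp_pos. unfold Rpower. now rewrite ln_exp.
Qed.

End CheckPolynomial.

(** * Negativity of the exponential rate *)

Section ExponentBound.

Variables (J beta theta : R).
Hypothesis J_ge3 : 3 <= J.
Hypothesis beta_gt0 : 0 < beta.
Hypothesis theta_01 : 0 < theta < 1.
Hypothesis v_le0 : forall c, 0 < c < 1 ->
  (c - 1) * J * ln (1 - c) - 2 * c * ln c + (1 + c) * (2 - J) * (1 - ln beta) <= 0.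

Lemma ln_le0 x : 0 < x <= 1 -> ln x <= 0.
Proof.
intros [h0 [h1|h1]].
- rewrite <- ln_1. left. apply ln_increasing; lra.
- subst x. rewrite ln_1. lra.
Qed.

Lemma ln_ge0 x : 1 <= x -> 0 <= ln x.
Proof. intros h. rewrite <- ln_1. apply ln_le; lra. Qed.

(** At [c = 1/2] both logarithmic terms of [v_le0] are nonnegative, so the last term cannot be
    positive. *)
Lemma ln_beta_le1 : ln beta <= 1.
Proof.
generalize (v_le0 (1 / 2) ltac:(lra)); intros h.
assert (h1 : ln (1 / 2) <= 0) by (apply ln_le0; lra).
replace (1 - 1 / 2) with (1 / 2) in h by lra.
nra.
Qed.

(** At the endpoints the logarithmic terms vanish, [ln 0] being multiplied by 0, and [ln beta <= 1]
    gives the sign. *)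
Lemma v_le0_closed c : 0 <= c <= 1 ->
  (c - 1) * J * ln (1 - c) - 2 * c * ln c + (1 + c) * (2 - J) * (1 - ln beta) <= 0.
Proof.
intros hc; generalize ln_beta_le1; intros hb.
destruct (Req_dec c 0) as [->|h0].
{ replace (1 - 0) with 1 by lra. rewrite ln_1. nra. }
destruct (Req_dec c 1) as [->|h1].
{ rewrite ln_1. nra. }
apply v_le0; lra.
Qed.

(** The gain, per unit of [1 + c], of passing from [d = beta] to [d = theta * beta]. *)
Let eta0 := (J - 2) / 2 * - ln theta.

(** The exponent of the bound on [E(a,b)] per unit of [b], at [c = a/b] and [d = theta * beta], up
    to the lower-order Stirling errors. The terms with [J - 1] come from the factorials, [J psi]
    from the power of [g_k], and the logarithms of [u] and [w] from dividing by [x^(ja) y^(jb)]. *)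
Definition rate (c u w psi : R) : R :=
  (1 + c) * ((J - 2) / 2) * ln (theta * beta) - (J - 1) * (1 + c)
  + (J - 1) * (c * ln c) + J * psi - J * ln u - J * (c * ln w).

(* The minimiser at [eps = 0] is [u^2 = 1 - c], [w = c / u]; [delta] keeps [w] bounded near [c = 1]. *)
Lemma rate_le_of_c_le2 c delta : 0 <= c <= 2 -> 0 < delta <= exp (-1) ->
  let u := sqrt (Rmax (1 - c) 0 + delta) in
  rate c u (c / u) (c + u * u / 2) <= - eta0 * (1 + c) + J * delta / 2.
Proof.
intros hc hd u.
assert (hm0 : 0 <= Rmax (1 - c) 0) by apply Rmax_r.
assert (hu : 0 < u) by (apply sqrt_lt_R0; lra).
assert (huu : u * u = Rmax (1 - c) 0 + delta) by (apply sqrt_sqrt; lra).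
assert (hln : 2 * ln u = ln (Rmax (1 - c) 0 + delta)).
{ rewrite <- huu, ln_mult by lra. lra. }
assert (hw : c * ln (c / u) = c * ln c - c * ln u).
{ destruct (Req_dec c 0) as [->|h0]; [lra|].
  unfold Rdiv. rewrite ln_mult, ln_Rinv; try lra. apply Rinv_0_lt_compat; lra. }
unfold rate, eta0. rewrite ln_mult, hw by lra.
assert (hb := ln_beta_le1).
assert (hlu : J * ln u - J * (c * ln u) = J * (1 - c) / 2 * (2 * ln u)) by lra.
destruct (Rle_dec c 1) as [h1|h1].
- assert (hM : Rmax (1 - c) 0 = 1 - c) by (apply Rmax_left; lra).
  rewrite hM in *.
  assert (hv := v_le0_closed c ltac:(lra)).
  (* Adding [delta] to [u^2] only lowers the logarithmic term; its cost is the [J delta / 2] coming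
     from [u * u / 2]. *)
  assert (h2 : (1 - c) * ln (1 - c) <= (1 - c) * (2 * ln u)).
  { destruct (Req_dec c 1) as [->|h0]; [lra|].
    apply Rmult_le_compat_l; [lra|]. rewrite hln. apply ln_le; lra. }
  assert (h3 : J * ((1 - c) * ln (1 - c)) <= J * ((1 - c) * (2 * ln u)))
    by (apply Rmult_le_compat_l; lra).
  rewrite huu. nra.
- assert (hM : Rmax (1 - c) 0 = 0) by (apply Rmax_right; lra).
  rewrite hM in *. rewrite Rplus_0_l in *.
  (* From [delta <= exp (-1)]: then [J (c-1) ln u <= - J (c-1) / 2], which cancels the [J (c-1) / 2]
     left by the other terms. *)
  assert (h2 : 2 * ln u <= -1).
  { rewrite hln, <- (ln_exp (-1)). apply ln_le; lra. }
  assert (h3 : 0 <= c * ln c) by (apply Rmult_le_pos; [lra | apply ln_ge0; lra]).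
  assert (h4 : J * (c - 1) * (2 * ln u) <= J * (c - 1) * (-1))
    by (apply Rmult_le_compat_l; [nra | lra]).
  assert (h5 : (1 + c) * ((J - 2) / 2) * ln beta <= (1 + c) * ((J - 2) / 2) * 1)
    by (apply Rmult_le_compat_l; [nra | lra]).
  rewrite huu. nra.
Qed.

(* Here the gain comes from the term [J (c - 1) ln eps]. *)
Lemma rate_le_of_c_ge2 c eps : 2 <= c -> 0 < eps <= exp (-15) ->
  let u := eps * exp (- (2 * c)) in let w := c / eps in
  rate c u w ((u * w + u * u / 2) * exp (eps * (u + w))) <= - eta0 * (1 + c).
Proof.
intros hc he u w.
assert (hle : ln eps <= -15).
{ rewrite <- (ln_exp (-15)). apply ln_le; lra. }
assert (he1 : eps <= 1).
{ apply Rle_trans with (exp (-15)); [lra|]. rewrite <- exp_0.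
  left; apply exp_increasing; lra. }
assert (hlu : ln u = ln eps - 2 * c).
{ unfold u. rewrite ln_mult, ln_exp; [lra | lra | apply exp_pos]. }
assert (hlw : ln w = ln c - ln eps).
{ unfold w, Rdiv. rewrite ln_mult, ln_Rinv; try lra. apply Rinv_0_lt_compat; lra. }
assert (hec : 0 < exp (- c)) by apply exp_pos.
assert (hec1 : exp (- c) <= 1).
{ rewrite <- exp_0. left; apply exp_increasing; lra. }
assert (he2c : exp (- (2 * c)) = exp (- c) * exp (- c)).
{ rewrite <- exp_plus. f_equal; lra. }
assert (hcc : c * exp (- c) <= 1).
{ assert (h := exp_ineq1_le c). assert (hp := exp_pos c).
  rewrite exp_Ropp. apply Rmult_le_reg_r with (exp c); [lra|].
  rewrite Rmult_assoc, Rinv_l by lra. lra. }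
assert (hu0 : 0 < u) by (apply Rmult_lt_0_compat; [lra | apply exp_pos]).
assert (hue : u <= exp (- c)).
{ unfold u; rewrite he2c.
  apply Rle_trans with (1 * (exp (- c) * 1)); [|lra].
  apply Rmult_le_compat; [lra | nra | lra |].
  apply Rmult_le_compat_l; lra. }
assert (huw : u * w <= exp (- c)).
{ replace (u * w) with (c * exp (- c) * exp (- c)); [nra|].
  unfold u, w. rewrite he2c. field. lra. }
assert (huu : u * u <= exp (- c)) by nra.
assert (hexp : exp (eps * (u + w)) <= 3 * exp c).
{ apply Rle_trans with (exp (1 + c)).
  - assert (eps * (u + w) <= 1 + c).
    { replace (eps * (u + w)) with (eps * u + c); [nra | unfold w; field; lra]. }
    apply exp_le; lra.
  - rewrite exp_plus. apply Rmult_le_compat_r; [left; apply exp_pos | apply exp_le_3]. }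
assert (hw0 : 0 < w) by (apply Rdiv_lt_0_compat; lra).
(* Since [eps * w = c], the exponential is of order [exp c]; the factor [exp (-2c)] in [u] outweighs
   it. *)
assert (hpsi : (u * w + u * u / 2) * exp (eps * (u + w)) <= 5).
{ apply Rle_trans with ((3 / 2 * exp (- c)) * (3 * exp c)).
  - apply Rmult_le_compat; [nra | left; apply exp_pos | lra | lra].
  - assert (exp (- c) * exp c = 1).
    { rewrite <- exp_plus. replace (- c + c) with 0 by lra. apply exp_0. }
    nra. }
unfold rate, eta0. rewrite hlu, hlw, ln_mult by lra.
assert (hb := ln_beta_le1).
assert (h3 : 0 <= c * ln c) by (apply Rmult_le_pos; [lra | apply ln_ge0; lra]).
assert (h5 : (1 + c) * ((J - 2) / 2) * ln beta <= (1 + c) * ((J - 2) / 2) * 1)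
  by (apply Rmult_le_compat_l; [nra | lra]).
assert (h6 := Rmult_le_compat_l J _ _ ltac:(lra) hpsi).
(* The positive remainder is at most [J (5 + 2c)], and [15 (c-1) >= 5 + 2c] for [c >= 2]. *)
assert (h7 : J * (c - 1) * ln eps <= J * (c - 1) * (-15))
  by (apply Rmult_le_compat_l; [nra | lra]).
nra.
Qed.

Lemma exists_rate_lt0 : exists eta eps0, 0 < eta /\ 0 < eps0 /\
  forall eps c, 0 < eps <= eps0 -> 0 <= c ->
  exists u w, 0 < u /\ 0 <= w /\ (0 < c -> 0 < w) /\
    rate c u w ((u * w + u * u / 2) * exp (eps * (u + w))) <= - eta * (1 + c).
Proof.
assert (he0 : 0 < eta0).
{ unfold eta0. assert (ln theta < 0) by (rewrite <- ln_1; apply ln_increasing; lra). nra. }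
set (delta := Rmin (exp (-1)) (eta0 / (2 * J))).
assert (hd0 : 0 < delta).
{ apply Rmin_pos; [apply exp_pos | apply Rdiv_lt_0_compat; lra]. }
assert (hd1 : delta <= exp (-1)) by apply Rmin_l.
assert (hd2 : J * delta / 2 <= eta0 / 4).
{ assert (h : delta <= eta0 / (2 * J)) by apply Rmin_r.
  apply (Rmult_le_compat_l J) in h; [|lra].
  replace (J * (eta0 / (2 * J))) with (eta0 / 2) in h by (field; lra). lra. }
assert (hsd : 0 < sqrt delta) by (apply sqrt_lt_R0; lra).
(* [M] bounds [u + w] on [c <= 2], since [sqrt delta <= u <= 2] and [w = c / u]. *)
set (M := 2 + 2 / sqrt delta).
assert (hM : 0 < M).
{ unfold M. assert (0 < 2 / sqrt delta) by (apply Rdiv_lt_0_compat; lra). lra. }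
assert (hl : 0 < ln (1 + eta0 / (12 * J))).
{ rewrite <- ln_1. apply ln_increasing; [lra|].
  assert (0 < eta0 / (12 * J)) by (apply Rdiv_lt_0_compat; lra). lra. }
(* The second bound makes [exp (eps M) <= 1 + eta0 / (12 J)]; as [c + u^2/2 <= 3], this costs at
   most [J * 3 * eta0 / (12 J) = eta0 / 4]. *)
exists (eta0 / 2), (Rmin (exp (-15)) (ln (1 + eta0 / (12 * J)) / M)).
split; [lra|]. split.
{ apply Rmin_pos; [apply exp_pos | apply Rdiv_lt_0_compat; lra]. }
intros eps c [hp hple] hc.
assert (hp1 := Rle_trans _ _ _ hple (Rmin_l _ _)).
assert (hp2 := Rle_trans _ _ _ hple (Rmin_r _ _)).
destruct (Rle_dec c 2) as [h2|h2].
- set (u := sqrt (Rmax (1 - c) 0 + delta)).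
  assert (hm0 : 0 <= Rmax (1 - c) 0) by apply Rmax_r.
  assert (hm1 : Rmax (1 - c) 0 <= 1) by (apply Rmax_lub; lra).
  assert (hu : 0 < u) by (apply sqrt_lt_R0; lra).
  assert (huu : u * u = Rmax (1 - c) 0 + delta) by (apply sqrt_sqrt; lra).
  assert (hd3 : delta <= 1).
  { apply Rle_trans with (1 := hd1). rewrite <- exp_0. left; apply exp_increasing; lra. }
  assert (hu2 : u <= 2) by nra.
  assert (hud : sqrt delta <= u) by (apply sqrt_le_1; lra).
  exists u, (c / u).
  assert (hw : 0 <= c / u).
  { apply Rmult_le_pos; [lra | left; apply Rinv_0_lt_compat; lra]. }
  assert (hw2 : c / u <= 2 / sqrt delta).
  { apply Rmult_le_compat; [lra | left; apply Rinv_0_lt_compat; lra | lra|].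
    apply Rinv_le_contravar; lra. }
  split; [exact hu|]. split; [exact hw|]. split.
  { intros h; apply Rdiv_lt_0_compat; lra. }
  assert (hr := rate_le_of_c_le2 c delta ltac:(lra) ltac:(lra)).
  cbv zeta in hr. fold u in hr.
  replace (u * (c / u)) with c by (field; lra).
  assert (hexp : exp (eps * (u + c / u)) <= 1 + eta0 / (12 * J)).
  { rewrite <- (exp_ln (1 + eta0 / (12 * J))).
    2:{ assert (0 < eta0 / (12 * J)) by (apply Rdiv_lt_0_compat; lra). lra. }
    assert (h : eps * (u + c / u) <= ln (1 + eta0 / (12 * J))).
    { apply Rle_trans with (eps * M).
      - apply Rmult_le_compat_l; [lra | unfold M; lra].
      - apply (Rmult_le_compat_r M) in hp2; [|lra].
        unfold Rdiv in hp2 at 1. rewrite Rmult_assoc, Rinv_l in hp2 by lra. lra. }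
    apply exp_le; lra. }
  assert (hpsi : (c + u * u / 2) * exp (eps * (u + c / u))
      <= (c + u * u / 2) + 3 * (eta0 / (12 * J))).
  { assert (0 < eta0 / (12 * J)) by (apply Rdiv_lt_0_compat; lra).
    apply Rle_trans with ((c + u * u / 2) * (1 + eta0 / (12 * J))).
    - apply Rmult_le_compat_l; [nra | lra].
    - nra. }
  apply (Rmult_le_compat_l J) in hpsi; [|lra].
  replace (J * (c + u * u / 2 + 3 * (eta0 / (12 * J))))
    with (J * (c + u * u / 2) + eta0 / 4) in hpsi by (field; lra).
  assert (0 <= eta0 * c) by (apply Rmult_le_pos; lra).
  unfold rate in *. lra.
- assert (hr := rate_le_of_c_ge2 c eps ltac:(lra) ltac:(lra)). cbv zeta in hr.
  exists (eps * exp (- (2 * c))), (c / eps).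
  assert (hx := exp_pos (- (2 * c))).
  assert (hw0 : 0 < c / eps) by (apply Rdiv_lt_0_compat; lra).
  split; [nra|]. split; [lra|]. split; [auto|].
  nra.
Qed.

End ExponentBound.

(** * Bounds on the individual terms [E(a,b)] *)

Lemma pow_exp_ln x m : (m <> 0%nat -> 0 < x) -> x ^ m = exp (INR m * ln x).
Proof.
intros h. destruct m as [|m]; [simpl; rewrite Rmult_0_l, exp_0; reflexivity|].
rewrite <- Rpower_pow by (apply h; lia). reflexivity.
Qed.

(* Only an exponential factor in [a + b] is lost: the usual entropy bounds lose a
   polynomial in [n], which would spoil the terms with small [b]. *)
Lemma trinom_ratio_le n j a b tau : (1 <= j)%nat -> (1 <= b)%nat -> (a + b <= n)%nat ->
  INR (n - (a + b)) >= exp (- tau) * INR n ->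
  trinom n a b / trinom (n * j) (j * a) (j * b) <=
  exp (INR (a + b) * ln (INR n) + ln (INR (fact (j * a))) + ln (INR (fact (j * b)))
       - ln (INR (fact a)) - ln (INR (fact b))
       - INR (j * (a + b)) * (ln (INR n) + ln (INR j) - tau)).
Proof.
intros hj hb hn ht. set (s := (a + b)%nat) in *.
assert (hs : (s = a + b)%nat) by reflexivity.
assert (hn0 : 0 < INR n) by (apply lt_0_INR; lia).
assert (hj0 : 0 < INR j) by (apply lt_0_INR; lia).
assert (h1 := fact_falling_le n s hn).
assert (h2 := fact_falling_ge (n * j) (j * s) ltac:(nia)).
replace (n * j - j * s)%nat with (j * (n - s))%nat in h2 by nia.
(* The hypothesis on [tau] replaces the base [j (n - s)] by [exp (-tau) j n]. *)
assert (h3 : exp (INR (j * s) * (ln (INR n) + ln (INR j) - tau)) <= INR (j * (n - s)) ^ (j * s)).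
{ apply Rle_trans with ((INR j * (exp (- tau) * INR n)) ^ (j * s)).
  - right. assert (he := exp_pos (- tau)).
    rewrite pow_exp_ln.
    + f_equal. f_equal. rewrite ln_mult, ln_mult, ln_exp; try lra.
      apply Rmult_lt_0_compat; lra.
    + intros _. apply Rmult_lt_0_compat; [lra | apply Rmult_lt_0_compat; lra].
  - apply pow_incr. rewrite mult_INR. assert (he := exp_pos (- tau)). split.
    + apply Rmult_le_pos; [lra | apply Rmult_le_pos; lra].
    + apply Rmult_le_compat_l; lra. }
unfold trinom.
destruct (Nat.leb_spec (a + b) n) as [_|]; [|lia].
destruct (Nat.leb_spec (j * a + j * b) (n * j)) as [_|]; [|nia].
replace (n - a - b)%nat with (n - s)%nat by lia.
replace (n * j - j * a - j * b)%nat with (j * (n - s))%nat by nia.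
unfold Rminus. rewrite !exp_plus, !exp_Ropp.
rewrite !exp_ln by apply INR_fact_lt_0.
rewrite <- (pow_exp_ln (INR n) s) by (intros; lra).
set (Z := exp (INR (j * s) * (ln (INR n) + ln (INR j) + - tau))).
change (Z <= INR (j * (n - s)) ^ (j * s)) in h3.
assert (hZ : 0 < Z) by apply exp_pos.
assert (p1 := INR_fact_lt_0 a). assert (p2 := INR_fact_lt_0 b).
assert (p3 := INR_fact_lt_0 (j * a)). assert (p4 := INR_fact_lt_0 (j * b)).
assert (p5 := INR_fact_lt_0 (n - s)). assert (p6 := INR_fact_lt_0 (j * (n - s))).
assert (p7 := INR_fact_lt_0 (n * j)). assert (p8 := INR_fact_lt_0 n).
set (F := INR (fact (j * a)) * INR (fact (j * b)) * / INR (fact a) * / INR (fact b)).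
assert (hF : 0 < F).
{ unfold F. repeat apply Rmult_lt_0_compat; try lra; apply Rinv_0_lt_compat; lra. }
(* The ratio is [F] times two quotients of factorials, bounded by [n^s] and [1/Z] respectively. *)
apply Rle_trans with
  (F * (INR (fact n) / INR (fact (n - s))) * (INR (fact (j * (n - s))) / INR (fact (n * j)))).
{ right. unfold F. field. repeat split; lra. }
apply Rle_trans with (F * INR n ^ s * / Z).
2:{ right. unfold F. ring. }
apply Rmult_le_compat.
- apply Rmult_le_pos; [lra|]. apply Rmult_le_pos; [lra | left; apply Rinv_0_lt_compat; lra].
- apply Rmult_le_pos; [lra | left; apply Rinv_0_lt_compat; lra].
- apply Rmult_le_compat_l; [lra|].
  apply Rmult_le_reg_r with (INR (fact (n - s))); [lra|].
  unfold Rdiv. rewrite Rmult_assoc, Rinv_l by lra. lra.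
- apply Rmult_le_reg_r with (INR (fact (n * j)) * Z); [apply Rmult_lt_0_compat; lra|].
  replace (INR (fact (j * (n - s))) / INR (fact (n * j)) * (INR (fact (n * j)) * Z))
    with (INR (fact (j * (n - s))) * Z) by (field; lra).
  replace (/ Z * (INR (fact (n * j)) * Z)) with (INR (fact (n * j))) by (field; lra).
  apply Rle_trans with (2 := h2). rewrite Rmult_comm. apply Rmult_le_compat_r; lra.
Qed.

Lemma S_njk_ge0 n j k a b : (1 <= k)%nat -> 0 <= S_njk n j k a b.
Proof. intros hk. apply bipow_ge0, g_coef_ge0, hk. Qed.

Lemma E_njk_ge0 n j k a b : (1 <= k)%nat -> (a + b <= n)%nat -> 0 <= E_njk n j k a b.
Proof.
intros hk h. unfold E_njk. apply Rmult_le_pos.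
- apply Rmult_le_pos; [apply trinom_ge0 | apply S_njk_ge0, hk].
- left. apply Rinv_0_lt_compat. unfold trinom.
  destruct (Nat.leb_spec (j * a + j * b) (n * j)) as [_|]; [|nia].
  apply Rdiv_lt_0_compat; [apply INR_fact_lt_0|].
  repeat apply Rmult_lt_0_compat; apply INR_fact_lt_0.
Qed.

Lemma E_njk_eq0 n j k a b : (1 <= k)%nat -> (1 <= j)%nat -> ((k - 1) * b < a)%nat ->
  E_njk n j k a b = 0.
Proof.
intros hk hj h. unfold E_njk, S_njk.
rewrite (bipow_support _ (k - 1)); [unfold Rdiv; ring | apply g_coef_support, hk | nia].
Qed.

(** The coefficient bound at [x = w r], [y = u r] with [r = eps/(k-1)]. As [m k = n j] and
    [r^2 = b / (n (k-1))], the prefactor [m k (k-1) r^2] becomes [j b]. *)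
Lemma S_njk_le n j k a b eps u w : (2 <= k)%nat -> Nat.divide k n -> (1 <= b)%nat ->
  (1 <= n)%nat -> 0 < u -> 0 <= w -> ((0 < a)%nat -> 0 < w) ->
  0 < eps -> eps * eps = (INR k - 1) * INR b / INR n ->
  S_njk n j k a b <=
  exp (INR j * INR b * ((u * w + u * u / 2) * exp (eps * (u + w)))
       - INR j * INR a * ln w - INR j * INR b * ln u
       - INR j * (INR a + INR b) * (ln (INR b) - ln (INR n) - ln (INR k - 1)) / 2).
Proof.
intros hk hdiv hb hn hu hw hw' he hee.
assert (hk1 : 0 < INR k - 1) by (apply le_INR in hk; simpl in hk; lra).
assert (hb0 : 0 < INR b) by (apply lt_0_INR; lia).
assert (hn0 : 0 < INR n) by (apply lt_0_INR; lia).
(* Divisibility of [n] by [k] makes the natural-number quotient exact. *)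
assert (hm : INR (n * j / k) * INR k = INR n * INR j).
{ rewrite <- !mult_INR. f_equal. destruct hdiv as [r ->].
  replace (r * k * j)%nat with (r * j * k)%nat by ring.
  rewrite Nat.div_mul by lia. reflexivity. }
set (r := eps / (INR k - 1)).
assert (hr : 0 < r) by (apply Rdiv_lt_0_compat; lra).
assert (hrr : r * r = INR b / (INR n * (INR k - 1))).
{ unfold r. replace (eps / (INR k - 1) * (eps / (INR k - 1)))
    with (eps * eps / ((INR k - 1) * (INR k - 1))) by (field; lra).
  rewrite hee. field. lra. }
assert (hlr : 2 * ln r = ln (INR b) - ln (INR n) - ln (INR k - 1)).
{ replace (2 * ln r) with (ln (r * r)) by (rewrite ln_mult; lra).
  rewrite hrr. unfold Rdiv. rewrite ln_mult, ln_Rinv, ln_mult; try lra.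
  - apply Rmult_lt_0_compat; lra.
  - apply Rinv_0_lt_compat, Rmult_lt_0_compat; lra. }
assert (hx : 0 <= w * r) by (apply Rmult_le_pos; lra).
assert (hy : 0 < u * r) by (apply Rmult_lt_0_compat; lra).
assert (hS := g_pow_coef_le k ltac:(lia) (w * r) (u * r) (n * j / k) (j * a) (j * b) hx ltac:(lra)).
fold (S_njk n j k a b) in hS.
replace (INR (n * j / k) * (INR k * (INR k - 1) * (w * r * (u * r) + u * r * (u * r) / 2) *
  exp ((INR k - 1) * (w * r + u * r))))
  with (INR j * INR b * ((u * w + u * u / 2) * exp (eps * (u + w)))) in hS.
2:{ replace ((INR k - 1) * (w * r + u * r)) with (eps * (u + w)) by (unfold r; field; lra).
    set (e := exp (eps * (u + w))).
    replace (INR (n * j / k) * (INR k * (INR k - 1) * (w * r * (u * r) + u * r * (u * r) / 2) * e))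
      with (INR (n * j / k) * INR k * ((INR k - 1) * (r * r) * (u * w + u * u / 2) * e)) by field.
    rewrite hm, hrr. field. lra. }
assert (hX : (w * r) ^ (j * a) = exp (INR j * INR a * ln w + INR j * INR a * ln r)).
{ rewrite <- mult_INR. destruct (Nat.eq_dec (j * a) 0) as [h0|h0].
  (* For [a = 0] the base [w * r] may be 0, and [0^0 = 1 = exp 0]. *)
  - rewrite h0. simpl. rewrite !Rmult_0_l, Rplus_0_r, exp_0. reflexivity.
  - assert (hw0 : 0 < w) by (apply hw'; nia).
    rewrite pow_exp_ln, ln_mult by (intros; nra).
    f_equal; ring. }
assert (hY : (u * r) ^ (j * b) = exp (INR j * INR b * ln u + INR j * INR b * ln r)).
{ rewrite <- mult_INR, pow_exp_ln, ln_mult by (intros; nra).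
  f_equal; ring. }
rewrite hX, hY, <- exp_plus in hS.
match type of hS with _ * exp ?B <= exp ?A =>
  apply Rmult_le_reg_r with (exp B); [apply exp_pos|];
  apply Rle_trans with (1 := hS); rewrite <- exp_plus; apply exp_le
end.
rewrite <- hlr. apply Req_le. field.
Qed.

(** Used to absorb polynomial factors into an arbitrarily weak exponential. *)
Lemma ln_le_linear tau x : 0 < tau -> 0 < x -> ln x <= tau * x - ln tau.
Proof.
intros ht hx. assert (h := ln_le_sub1 (tau * x) ltac:(apply Rmult_lt_0_compat; lra)).
rewrite ln_mult in h by lra. lra.
Qed.

(** Stirling's upper bound for [(ja)!], [(jb)!] and lower bound for [a!], [b!] leave the error
    [2 + ln (ja+1) + ln (jb+1)]. The rest is [b] times the rate, the loss [j tau (a+b)], and a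
    correction for [D] differing from [theta * beta]. *)
Lemma E_njk_le n j k a b eps u w theta beta eta tau :
  (3 <= j)%nat -> (2 <= k)%nat -> Nat.divide k n -> (1 <= b)%nat -> (a + b <= n)%nat ->
  0 < theta -> 0 < beta ->
  0 < eps -> eps * eps = (INR k - 1) * INR b / INR n ->
  INR (n - (a + b)) >= exp (- tau) * INR n ->
  0 < u -> 0 <= w -> ((0 < a)%nat -> 0 < w) ->
  rate (INR j) beta theta (INR a / INR b) u w ((u * w + u * u / 2) * exp (eps * (u + w)))
    <= - eta * (1 + INR a / INR b) ->
  let D := INR b / INR n * Rpower (INR k - 1) (INR j / (INR j - 2)) in
  E_njk n j k a b <=
  exp (2 + ln (INR j * INR a + 1) + ln (INR j * INR b + 1)
       + (INR a + INR b) * (INR j * tau - eta)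
       + (INR a + INR b) * (INR j - 2) / 2 * (ln D - ln (theta * beta))).
Proof.
intros hj hk hdiv hb hn hth hbe he hee ht hu hw hw' hrate D.
assert (hk1 : 0 < INR k - 1) by (apply le_INR in hk; simpl in hk; lra).
assert (hb0 : 0 < INR b) by (apply lt_0_INR; lia).
assert (hn0 : 0 < INR n) by (apply lt_0_INR; lia).
assert (hj0 : 3 <= INR j) by (apply le_INR in hj; simpl in hj; lra).
assert (hlnD : ln D = ln (INR b) - ln (INR n) + INR j / (INR j - 2) * ln (INR k - 1)).
{ unfold D, Rdiv. rewrite ln_mult, ln_mult, ln_Rinv; try lra.
  - unfold Rpower. rewrite ln_exp. lra.
  - apply Rinv_0_lt_compat; lra.
  - apply Rmult_lt_0_compat; [lra | apply Rinv_0_lt_compat; lra].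
  - apply exp_pos. }
assert (hT := trinom_ratio_le n j a b tau ltac:(lia) hb hn ht).
assert (hS := S_njk_le n j k a b eps u w hk hdiv hb ltac:(lia) hu hw hw' he hee).
set (psi := (u * w + u * u / 2) * exp (eps * (u + w))) in *.
replace (E_njk n j k a b)
  with (trinom n a b / trinom (n * j) (j * a) (j * b) * S_njk n j k a b)
  by (unfold E_njk, Rdiv; ring).
assert (hE0 : 0 <= trinom n a b / trinom (n * j) (j * a) (j * b)).
{ apply Rmult_le_pos; [apply trinom_ge0|]. left; apply Rinv_0_lt_compat. unfold trinom.
  destruct (Nat.leb_spec (j * a + j * b) (n * j)) as [_|]; [|nia].
  apply Rdiv_lt_0_compat; [apply INR_fact_lt_0|].
  repeat apply Rmult_lt_0_compat; apply INR_fact_lt_0. }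
eapply Rle_trans.
{ apply Rmult_le_compat; [exact hE0 | apply S_njk_ge0; lia | exact hT | exact hS]. }
rewrite <- exp_plus. apply exp_le.
assert (f1 := ln_fact_le (j * a)). assert (f2 := ln_fact_le (j * b)).
assert (f3 := ln_fact_ge a). assert (f4 := ln_fact_ge b).
rewrite !mult_INR, ?plus_INR in *.
(* Logarithms are expressed through the ratio [a/b]; for [a = 0] both sides vanish whatever [ln 0]
   is. *)
assert (hla : INR a * ln (INR a) = INR a * ln (INR a / INR b) + INR a * ln (INR b)).
{ destruct a as [|a']; [simpl; ring|].
  assert (0 < INR (S a')) by (apply lt_0_INR; lia).
  unfold Rdiv. rewrite ln_mult, ln_Rinv; try lra. apply Rinv_0_lt_compat; lra. }
assert (hja : INR j * INR a * ln (INR j * INR a) =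
  INR j * INR a * ln (INR j) + INR j * (INR a * ln (INR a))).
{ destruct a as [|a']; [simpl; ring|].
  assert (0 < INR (S a')) by (apply lt_0_INR; lia). rewrite ln_mult by lra. ring. }
rewrite hja, hla in f1. rewrite hla in f3.
rewrite (ln_mult (INR j) (INR b)) in f2 by lra.
apply (Rmult_le_compat_l (INR b)) in hrate; [|lra].
replace (INR b * (- eta * (1 + INR a / INR b))) with (- eta * (INR a + INR b)) in hrate
  by (field; lra).
unfold rate in hrate.
match type of hrate with ?L <= _ =>
  replace L with ((INR a + INR b) * ((INR j - 2) / 2) * ln (theta * beta)
    - (INR j - 1) * (INR a + INR b) + (INR j - 1) * (INR a * ln (INR a / INR b))
    + INR j * INR b * psi - INR j * INR b * ln u - INR j * (INR a * ln w)) in hrate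
    by (field; lra)
end.
(* The exponent [j/(j-2)] in [D] makes [(j-2)/2 * ln D] contain exactly the [j/2 * ln (k-1)] left by
   the bound on [S_njk]. *)
assert (hD : (INR a + INR b) * (INR j - 2) / 2 * ln D =
  (INR a + INR b) * (INR j - 2) / 2 * (ln (INR b) - ln (INR n))
  + (INR a + INR b) * INR j / 2 * ln (INR k - 1)).
{ rewrite hlnD. field. lra. }
lra.
Qed.

(** * Choice of [K], geometric decay and summation *)

Lemma vfun_le0 j beta : 0 < beta ->
  is_lub (fun y => exists c, 0 < c < 1 /\ y = vfun j c beta) 0 ->
  forall c, 0 < c < 1 -> (c - 1) * INR j * ln (1 - c) - 2 * c * ln c
    + (1 + c) * (2 - INR j) * (1 - ln beta) <= 0.
Proof.
intros hbeta [hub _] c hc.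
assert (h : vfun j c beta <= 0) by (apply hub; exists c; split; [exact hc | reflexivity]).
unfold vfun in h.
apply Rmult_le_reg_l with (beta / 2); [lra|]. rewrite Rmult_0_r. exact h.
Qed.

(** The sum runs over [b <= kappa n], which is the condition [D <= theta * beta]. *)
Definition kappa (j k : nat) (theta beta : R) : R :=
  theta * beta * Rpower (INR k - 1) (- INR j / (INR j - 2)).

Lemma kappa_gt0 j k theta beta : 0 < theta -> 0 < beta -> 0 < kappa j k theta beta.
Proof.
intros; unfold kappa. apply Rmult_lt_0_compat; [nra | apply exp_pos].
Qed.

(** [(k-1) kappa = theta beta (k-1)^(-2/(j-2))] tends to 0, and it bounds [eps^2 = (k-1) b / n] over
    the range of summation. *)
Lemma kappa_small j theta beta sigma : 0 < theta -> 0 < beta -> 0 < sigma -> (3 <= j)%nat ->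
  exists K, (2 <= K)%nat /\ forall k, (K <= k)%nat ->
    (INR k - 1) * kappa j k theta beta <= sigma.
Proof.
intros hth hbe hs hj.
assert (hj0 : 3 <= INR j) by (apply le_INR in hj; simpl in hj; lra).
(* The threshold solves [theta beta (k-1)^(-2/(j-2)) = sigma] for [k]. *)
destruct (INR_unbounded (exp ((INR j - 2) / 2 * (ln (theta * beta) - ln sigma)) + 1)) as [K0 hK0].
exists (Nat.max 2 K0). split; [lia|]. intros k hk.
assert (hk2 : (2 <= k)%nat) by lia.
assert (hk1 : 0 < INR k - 1) by (apply le_INR in hk2; simpl in hk2; lra).
assert (hk0 : INR K0 <= INR k) by (apply le_INR; lia).
assert (hl : (INR j - 2) / 2 * (ln (theta * beta) - ln sigma) <= ln (INR k - 1)).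
{ rewrite <- (ln_exp ((INR j - 2) / 2 * (ln (theta * beta) - ln sigma))).
  apply ln_le; [apply exp_pos | lra]. }
assert (htb : 0 < theta * beta) by (apply Rmult_lt_0_compat; lra).
rewrite <- (exp_ln ((INR k - 1) * kappa j k theta beta))
  by (apply Rmult_lt_0_compat; [lra | apply kappa_gt0; lra]).
rewrite <- (exp_ln sigma) by lra. apply exp_le.
rewrite ln_mult by (try apply kappa_gt0; lra).
unfold kappa. rewrite (ln_mult (theta * beta)) by (try apply exp_pos; lra).
unfold Rpower. rewrite ln_exp.
replace (ln (INR k - 1) + (ln (theta * beta) + - INR j / (INR j - 2) * ln (INR k - 1)))
  with (ln (theta * beta) - 2 / (INR j - 2) * ln (INR k - 1)) by (field; lra).
apply (Rmult_le_compat_l (2 / (INR j - 2))) in hl; [|left; apply Rdiv_lt_0_compat; lra].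
replace (2 / (INR j - 2) * ((INR j - 2) / 2 * (ln (theta * beta) - ln sigma)))
  with (ln (theta * beta) - ln sigma) in hl by (field; lra).
lra.
Qed.

(** Decay in [n] comes from the correction term: [b / (kappa n) <= 1] is raised to a power of at
    least 1/2, giving [n^(-1/2)] times [b^(1/2)], and [q^b] absorbs the latter. Only [C] depends on
    [k], through [kappa]. *)
Lemma E_njk_geometric j beta theta : (3 <= j)%nat -> 0 < beta -> 0 < theta < 1 ->
  is_lub (fun y => exists c, 0 < c < 1 /\ y = vfun j c beta) 0 ->
  exists K q, (2 <= K)%nat /\ 0 < q < 1 /\ forall k, (K <= k)%nat ->
  exists C, 0 < C /\ forall n a b, Nat.divide k n -> (1 <= b)%nat -> (a + b <= n)%nat ->
    INR b <= kappa j k theta beta * INR n ->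
    E_njk n j k a b <= C * exp (- (ln (INR n) / 2)) * q ^ b * q ^ a.
Proof.
intros hj hbeta hth hsup.
assert (hj0 : 3 <= INR j) by (apply le_INR in hj; simpl in hj; lra).
destruct (exists_rate_lt0 (INR j) beta theta hj0 hbeta hth (vfun_le0 j beta hbeta hsup))
  as (eta & eps0 & heta & heps0 & hrate).
(* Of the rate [eta], one quarter pays for [j tau], one for the factors [ja+1] and [jb+1], and an
   eighth for [b^(1/2)]; at least [eta / 4] remains for [q]. *)
set (tau := eta / (4 * INR j)).
assert (htau : 0 < tau) by (apply Rdiv_lt_0_compat; lra).
assert (htau1 : exp (- tau) < 1) by (rewrite <- exp_0; apply exp_increasing; lra).
(* The first bound gives [eps <= eps0]; the second gives
   [a + b <= 2 (k-1) b <= (1 - exp (-tau)) n]. *)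
set (sigma := Rmin (eps0 * eps0) ((1 - exp (- tau)) / 2)).
assert (hs0 : 0 < sigma) by (apply Rmin_pos; [apply Rmult_lt_0_compat|]; lra).
assert (hs1 : sigma <= eps0 * eps0) by apply Rmin_l.
assert (hs2 : sigma <= (1 - exp (- tau)) / 2) by apply Rmin_r.
destruct (kappa_small j theta beta sigma) as (K & hK & hkap); try lra; try assumption.
exists K, (exp (- (eta / 4))). split; [exact hK|]. split.
{ split; [apply exp_pos|]. rewrite <- exp_0. apply exp_increasing; lra. }
intros k hk. specialize (hkap k hk).
assert (hk2 : (2 <= k)%nat) by lia.
assert (hk1 : 1 <= INR k - 1) by (apply le_INR in hk2; simpl in hk2; lra).
set (kap := kappa j k theta beta) in *.
assert (hkap0 : 0 < kap) by (apply kappa_gt0; lra).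
(* Constants from Stirling, from the two linear factors, from [b^(1/2)] and from [kappa^(-1/2)]. *)
exists (exp (2 + 2 * (tau - ln tau) - ln (eta / 4) / 2 - ln kap / 2)).
split; [apply exp_pos|].
intros n a b hdiv hb hn hbn.
assert (hb0 : 0 < INR b) by (apply lt_0_INR; lia).
assert (hb1 : 1 <= INR b) by (apply le_INR in hb; simpl in hb; lra).
assert (ha0 : 0 <= INR a) by apply pos_INR.
assert (hn0 : 0 < INR n) by (apply lt_0_INR; lia).
destruct (Nat.lt_ge_cases ((k - 1) * b) a) as [hab|hab].
{ rewrite E_njk_eq0 by lia.
  repeat apply Rmult_le_pos; try apply pow_le; left; apply exp_pos. }
assert (hkb : (INR k - 1) * INR b <= sigma * INR n).
{ apply Rle_trans with ((INR k - 1) * (kap * INR n)); [apply Rmult_le_compat_l; lra|].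
  rewrite <- Rmult_assoc. apply Rmult_le_compat_r; lra. }
set (eps := sqrt ((INR k - 1) * INR b / INR n)).
assert (hkbn : 0 < (INR k - 1) * INR b / INR n).
{ apply Rdiv_lt_0_compat; [apply Rmult_lt_0_compat; lra | lra]. }
assert (heps : 0 < eps) by (apply sqrt_lt_R0; lra).
assert (hee : eps * eps = (INR k - 1) * INR b / INR n) by (apply sqrt_sqrt; lra).
assert (heps1 : eps <= eps0).
{ rewrite <- (sqrt_square eps0) by lra. apply sqrt_le_1; [lra | nra|].
  apply Rle_trans with sigma; [|lra].
  apply Rmult_le_reg_r with (INR n); [lra|].
  unfold Rdiv. rewrite Rmult_assoc, Rinv_l by lra. lra. }
assert (ht : INR (n - (a + b)) >= exp (- tau) * INR n).
{ rewrite minus_INR, plus_INR by lia.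
  apply le_INR in hab. rewrite mult_INR, minus_INR in hab by lia. simpl (INR 1) in hab.
  assert (sigma * INR n <= (1 - exp (- tau)) / 2 * INR n) by (apply Rmult_le_compat_r; lra).
  assert (1 * INR b <= (INR k - 1) * INR b) by (apply Rmult_le_compat_r; lra).
  lra. }
destruct (hrate eps (INR a / INR b)) as (u & w & hu & hw & hw' & hr); [lra | |].
{ apply Rmult_le_pos; [lra | left; apply Rinv_0_lt_compat; lra]. }
assert (hE := E_njk_le n j k a b eps u w theta beta eta tau hj hk2 hdiv hb hn
  ltac:(lra) hbeta heps hee ht hu hw
  (fun h => hw' (Rdiv_lt_0_compat _ _ (lt_0_INR _ h) hb0)) hr).
cbv zeta in hE. apply Rle_trans with (1 := hE).
rewrite !pow_exp_ln by (intros; apply exp_pos). rewrite !ln_exp, <- !exp_plus. apply exp_le.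
assert (hD : ln (INR b / INR n * Rpower (INR k - 1) (INR j / (INR j - 2))) - ln (theta * beta)
  = ln (INR b) - ln (INR n) - ln kap).
{ assert (0 < / INR n) by (apply Rinv_0_lt_compat; lra).
  unfold Rdiv at 1. rewrite ln_mult, ln_mult, ln_Rinv by (try apply exp_pos; nra).
  unfold kap, kappa. rewrite (ln_mult (theta * beta)) by (try apply exp_pos; nra).
  unfold Rpower. rewrite !ln_exp. field. lra. }
rewrite hD.
assert (hL : ln (INR b) - ln (INR n) - ln kap <= 0).
{ assert (h : ln (INR b) <= ln (kap * INR n)) by (apply ln_le; lra).
  rewrite ln_mult in h by lra. lra. }
(* The logarithm is nonpositive and its coefficient is at least 1/2, because [b >= 1] and
   [j >= 3]. *)
assert (hL2 : (INR a + INR b) * (INR j - 2) / 2 * (ln (INR b) - ln (INR n) - ln kap)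
  <= 1 / 2 * (ln (INR b) - ln (INR n) - ln kap)).
{ assert (1 / 2 <= (INR a + INR b) * (INR j - 2) / 2) by nra. nra. }
assert (hla : ln (INR j * INR a + 1) <= eta / 4 * INR a + tau - ln tau).
{ assert (h := ln_le_linear tau (INR j * INR a + 1) htau ltac:(nra)).
  replace (tau * (INR j * INR a + 1)) with (eta / 4 * INR a + tau) in h
    by (unfold tau; field; lra). lra. }
assert (hlb : ln (INR j * INR b + 1) <= eta / 4 * INR b + tau - ln tau).
{ assert (h := ln_le_linear tau (INR j * INR b + 1) htau ltac:(nra)).
  replace (tau * (INR j * INR b + 1)) with (eta / 4 * INR b + tau) in h
    by (unfold tau; field; lra). lra. }
assert (hlb2 := ln_le_linear (eta / 4) (INR b) ltac:(lra) hb0).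
replace (INR j * tau) with (eta / 4) by (unfold tau; field; lra).
assert (0 <= eta * INR a) by (apply Rmult_le_pos; lra).
assert (0 <= eta * INR b) by (apply Rmult_le_pos; lra).
lra.
Qed.

Lemma lt_bmax j k theta beta n i :
  (i < bmax j k theta beta n)%nat -> INR (S i) <= kappa j k theta beta * INR n.
Proof.
intros h. unfold bmax in h. fold (kappa j k theta beta) in h.
set (r := kappa j k theta beta * INR n) in *.
destruct (base_Int_part r) as [h1 _].
apply Rle_trans with (IZR (Int_part r)); [|exact h1].
rewrite INR_IZR_INZ. apply IZR_le. lia.
Qed.

Theorem theorem7 (j : nat) (hj : (3 <= j)%nat)
  (beta : R) (hbeta : 0 < beta)
  (hsup : is_lub (fun y => exists c, 0 < c < 1 /\ y = vfun j c beta) 0)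
  (theta : R) (htheta : 0 < theta < 1) :
  exists K : nat, forall k : nat, (K <= k)%nat ->
    forall eps : R, eps > 0 ->
      exists N : nat, forall n : nat, (N <= n)%nat -> Nat.divide k n ->
        Rabs (LM1sum j k theta beta n) < eps.
Proof.
destruct (E_njk_geometric j beta theta hj hbeta htheta hsup) as (K & q & hK & hq & hE).
exists K. intros k hk eps heps.
destruct (hE k hk) as (C & hC & hEk).
(* One factor [1/(1-q)] for the sum over [a], one for the sum over [b]. *)
set (A := C * (/ (1 - q) * / (1 - q))).
assert (hq1 : 0 < / (1 - q)) by (apply Rinv_0_lt_compat; lra).
assert (hA : 0 < A) by (repeat apply Rmult_lt_0_compat; lra).
assert (heA : 0 < eps / A) by (apply Rdiv_lt_0_compat; lra).
(* [N > (eps/A)^(-2)], so that [n^(-1/2) < eps/A] from [N] on. *)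
destruct (INR_unbounded (exp (- (2 * ln (eps / A))))) as [N hN].
exists N. intros n hn hdiv.
assert (hNn : INR N <= INR n) by (apply le_INR; lia).
assert (hsmall : exp (- (ln (INR n) / 2)) < eps / A).
{ rewrite <- (exp_ln (eps / A)) by lra. apply exp_increasing.
  assert (h : ln (exp (- (2 * ln (eps / A)))) < ln (INR n)).
  { apply ln_increasing; [apply exp_pos | lra]. }
  rewrite ln_exp in h. lra. }
set (g := exp (- (ln (INR n) / 2))) in *.
assert (hg : 0 < g) by apply exp_pos.
assert (hpow : forall i, 0 < q ^ i) by (intros; apply pow_lt; lra).
assert (hCg : 0 < C * g) by (apply Rmult_lt_0_compat; lra).
assert (h0 : 0 <= LM1sum j k theta beta n).
{ apply rsum_ge0; intros i hi; cbv zeta; apply rsum_ge0; intros a ha.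
  apply E_njk_ge0; lia. }
rewrite Rabs_pos_eq by exact h0.
apply Rle_lt_trans with (A * g).
2:{ apply (Rmult_lt_compat_l A) in hsmall; [|lra].
    replace (A * (eps / A)) with eps in hsmall by (field; lra). exact hsmall. }
apply Rle_trans with
  (rsum (bmax j k theta beta n) (fun i => C * g * / (1 - q) * q ^ i)).
- apply rsum_le; intros i hi. cbv zeta.
  apply Rle_trans with (rsum (S n - S i) (fun a => C * g * q ^ S i * q ^ a)).
  + apply rsum_le; intros a ha.
    apply hEk; try assumption; try lia. apply lt_bmax; assumption.
  + rewrite rsum_mull.
    assert (hs := rsum_geom_le (S n - S i) q hq).
    apply Rle_trans with (C * g * q ^ S i * / (1 - q)).
    * apply Rmult_le_compat_l; [|exact hs]. left; apply Rmult_lt_0_compat; [lra | apply hpow].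
    (* The index [i] stands for [b = i + 1]; enlarging [q^b] to [q^i] gives a geometric series
       starting at exponent 0. *)
    * assert (hqi : q ^ S i <= q ^ i) by (specialize (hpow i); simpl; nra).
      replace (C * g * q ^ S i * / (1 - q)) with (C * g * / (1 - q) * q ^ S i) by ring.
      apply Rmult_le_compat_l; [left; apply Rmult_lt_0_compat; lra | exact hqi].
- rewrite rsum_mull.
  assert (hs := rsum_geom_le (bmax j k theta beta n) q hq).
  replace (A * g) with (C * g * / (1 - q) * / (1 - q)) by (unfold A; ring).
  apply Rmult_le_compat_l; [left; apply Rmult_lt_0_compat; lra | exact hs].
Qed.
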